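(* Let $d\ge 0$ be an integer, $\alpha_1,\dots,\alpha_d\in\mathbb{C}$, $\rho\in\mathbb{C}\setminus\{0\}$, $R(H)=\rho\prod_{j=1}^{d}(H+\alpha_j+1)$, and $G=R(H)\Delta$, where $H=-x\nabla$. For $n\ge0$ let $P_n(x)=e^{G}\psi(x,n)$ with $\psi(x,n)=(-1)^n(-x)_n$. Then the polynomials $P_n(x)$ have the hypergeometric representations $$P_n(x)=(-1)^n(-x)_n\;{}_{d+1}F_1\left[\begin{matrix}-n,-n-\alpha_1,\dots,-n-\alpha_d\\ x-n+1\end{matrix};(-1)^{d+1}\rho\right]$$ and, provided no $\alpha_k$ is a negative integer, $$P_n(x)=\prod_{k=1}^{d}(\alpha_k+1)_n\;{}_2F_d\left[\begin{matrix}-n,-x\\ \alpha_1+1,\dots,\alpha_d+1\end{matrix};\rho\right].$$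
   Context: Operators act on $\mathbb{C}[x]$: $\Delta f(x)=f(x+1)-f(x)$, $\nabla f(x)=f(x-1)-f(x)$. One has $\psi(x,n)=(-1)^n(-x)_n=x(x-1)\cdots(x-n+1)$, and $e^{G}\psi(x,n)=\sum_{j\ge0}\frac{G^j\psi(x,n)}{j!}$ (a finite sum because $G$ lowers the degree). Pochhammer symbol: $(a)_0=1$, $(a)_j=a(a+1)\cdots(a+j-1)$. Generalized hypergeometric series: ${}_pF_q\left[\begin{matrix}a_1,\dots,a_p\\ b_1,\dots,b_q\end{matrix};z\right]=\sum_{j\ge0}\frac{(a_1)_j\cdots(a_p)_j}{(b_1)_j\cdots(b_q)_j}\frac{z^j}{j!}$; both series here terminate because of the parameter $-n$.
   Formalization: The second formula as printed is false for general ρ (d=0, n=1: P_1 = x+ρ, but the right side is 1+ρx); the formal theorem proves it with an extra factor ρ^n in front and argument 1/ρ in place of ρ. *)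

(* Defs.v *)
From mathcomp Require Import all_boot all_order all_algebra fraction.
From mathcomp Require Import classical_sets fsbigop reals.
From mathcomp.real_closed Require Export complex.

Set Implicit Arguments.
Unset Strict Implicit.
Unset Printing Implicit Defensive.

Import GRing.Theory.
Local Open Scope classical_set_scope.
Local Open Scope ring_scope.

Definition poch (A : pzRingType) (a : A) (j : nat) : A :=
  \prod_(i < j) (a + i%:R).

Definition hyp_term (K : fieldType) (As Bs : seq K) (z : K) (j : nat) : K :=
  (\prod_(a <- As) poch a j) / (\prod_(b <- Bs) poch b j) * (z ^+ j / j`!%:R).

(* [\sum_(j \in setT)] is the sum over the finite support, so this is the
   value of a terminating series.  If [- n%:R] is one of the numerator
   parameters, then all terms with [n < j] vanish, also when a denominator
   is zero, because [0 / 0 = 0]. *)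
Definition hyp (K : fieldType) (As Bs : seq K) (z : K) : K :=
  \sum_(j \in [set: nat]) hyp_term As Bs z j.

Section Operators.
Variable C : fieldType.
Implicit Types (f p : {poly C}) (T : {poly C} -> {poly C}).

Definition Delta f : {poly C} := f \Po ('X + 1) - f.
Definition Nabla f : {poly C} := f \Po ('X - 1) - f.
Definition Hop f : {poly C} := - ('X * Nabla f).

Definition op_eval p T f : {poly C} := \sum_(i < size p) p`_i *: iter i T f.

(* Meaningful when [T] lowers the degree: the sum over the finite support is
   then the whole exponential series. *)
Definition op_exp T f : {poly C} :=
  \sum_(j \in [set: nat]) (j`!%:R^-1 *: iter j T f).

Definition psi (n : nat) : {poly C} := (-1) ^+ n *: poch (- 'X) n.

Definition Rpoly (d : nat) (alpha : d.-tuple C) (rho : C) : {poly C} :=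
  rho *: \prod_(a <- alpha) ('X + (a + 1)%:P).

Definition Gop (d : nat) (alpha : d.-tuple C) (rho : C) f : {poly C} :=
  op_eval (Rpoly alpha rho) Hop (Delta f).

Definition Ppoly (d : nat) (alpha : d.-tuple C) (rho : C) (n : nat) :
  {poly C} := op_exp (Gop alpha rho) (psi n).

Definition ratconst (c : C) : {fraction {poly C}} := tofrac c%:P.
Definition ratX : {fraction {poly C}} := tofrac 'X.

End Operators.

(* Main.v *)
Require Import Defs.
From mathcomp Require Import all_boot all_order all_algebra fraction reals.
From mathcomp Require Import classical_sets fsbigop ring.

Set Implicit Arguments.
Unset Strict Implicit.
Unset Printing Implicit Defensive.

Import GRing.Theory.
Local Open Scope ring_scope.

(** Everything follows from the action of the operators on the basis
    [psi n = x (x - 1) ... (x - n + 1)].  Since [H psi n = n psi n] and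
    [Delta psi n = n psi (n - 1)], the operator [G = R(H) Delta] is a weighted
    lowering operator ([Gop_psi]):
      [G psi n = n R(n - 1) psi (n - 1)],
    where [n R(n - 1) = n rho \prod_a (n + a)].  Hence [P_n] is the explicit
    finite sum [PpolyE] of the terms
      [1 / j! * (\prod_(i < j) (n - i) R(n - i - 1)) * psi (n - j)],
    and both hypergeometric formulas are ways of writing this sum.

    In the order of increasing [j], the product of the weights collects into
    the Pochhammer symbols of [- n] and of the [- n - a]
    ([prod_lowering_down]), while
    [psi (n - j) = psi n / (x - n + 1)_j] ([falling_split]).  This argument
    is valid at a point [x] of any field where the divisions make sense, so
    the same lemma [first_representation] gives the identity at a scalar and,
    with the indeterminate as the point, the identity of rational functions.

    In the reversed order [j = n - k], the product of the weights is the full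
    product [n! rho ^ n \prod_a (a + 1)_n] divided by the product of the [k]
    lowest weights, [k! rho ^ k \prod_a (a + 1)_k]
    ([prod_lowering_telescope], [prod_lowering_up]).  The quotient of the two
    is the source of the prefactor, of the lower parameters [a + 1] and of
    the argument [1 / rho] in [second_representation]. *)

(** * Terminating sums *)

Lemma sum_nat_support (V : nmodType) (F : nat -> V) (n : nat) :
  (forall j, (n < j)%N -> F j = 0) ->
  \sum_(j \in [set: nat]%classic) F j = \sum_(j < n.+1) F j.
Proof.
move=> F0; rewrite -(big_mkord xpredT F).
rewrite (fsbigE (index_iota 0 n.+1)) ?iota_uniq //; last first.
  by move=> j _; rewrite mem_index_iota /= -ltnNge => /F0.
by apply: eq_bigl => j; rewrite in_setT.
Qed.

Lemma poch_negn0 (A : comPzRingType) (n j : nat) :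
  (n < j)%N -> poch (- n%:R : A) j = 0.
Proof.
by move=> nj; rewrite /poch (bigD1 (Ordinal nj)) //= addNr mul0r.
Qed.

(** The factor [(- n)_j] kills the terms beyond [n], including those with a
    vanishing denominator, whose value is [0 / 0 = 0]. *)
Lemma hyp_terminating (K : fieldType) (As Bs : seq K) (z : K) (n : nat) :
  hyp (- n%:R :: As) Bs z = \sum_(j < n.+1) hyp_term (- n%:R :: As) Bs z j.
Proof.
apply: sum_nat_support => j nj.
by rewrite /hyp_term big_cons poch_negn0 // !mul0r.
Qed.

(** * Falling factorials *)

Definition falling (A : pzRingType) (x : A) (n : nat) : A :=
  \prod_(i < n) (x - i%:R).

Section Falling.
Variable A : comPzRingType.
Implicit Types x : A.

Lemma signed_poch x n : (-1) ^+ n * poch (- x) n = falling x n.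
Proof.
rewrite /poch -[n in _ ^+ n]card_ord -prodr_const -big_split /=.
by apply: eq_bigr => i _; ring.
Qed.

Lemma poch_opp x n : poch (- x) n = (-1) ^+ n * falling x n.
Proof. by rewrite -signed_poch signrMK. Qed.

Lemma fallingSr x n : falling x n.+1 = falling x n * (x - n%:R).
Proof. by rewrite /falling big_ord_recr. Qed.

Lemma fallingSl x n : falling x n.+1 = x * falling (x - 1) n.
Proof.
rewrite /falling big_ord_recl subr0; congr (_ * _).
by apply: eq_bigr => i _; rewrite /= /bump add1n -natr1; ring.
Qed.

Lemma falling_nat (m n : nat) : falling (m%:R : A) n = (m ^_ n)%:R.
Proof.
elim: n => [|n IHn]; first by rewrite /falling big_ord0 ffactn0.
rewrite fallingSr IHn ffactnSr natrM.
have [nm|mn] := leqP n m; first by rewrite natrB.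
by rewrite ffact_small // !mul0r.
Qed.

(** The last [j] factors of the falling factorial, read backwards, are
    [x - n + 1, ..., x - n + j]; this is where the lower parameter of the
    first formula comes from. *)
Lemma falling_split x n j : (j <= n)%N ->
  falling x n = falling x (n - j) * poch (x - n%:R + 1) j.
Proof.
move=> jn; rewrite /falling -[in LHS](subnK jn) big_split_ord /=; congr (_ * _).
rewrite /poch [RHS](reindex_inj rev_ord_inj) /=.
apply: eq_bigr => i _; rewrite natrD !natrB ?ltn_ord // -natr1; ring.
Qed.

End Falling.

Lemma rmorph_falling (A B : pzRingType) (f : {rmorphism A -> B}) x n :
  f (falling x n) = falling (f x) n.
Proof.
by rewrite rmorph_prod; apply: eq_bigr => i _; rewrite rmorphB rmorph_nat.
Qed.

(** * The weights of the lowering operator *)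

(** This is [k R(k - 1)], the scalar by which [G] maps [psi k] to
    [psi (k - 1)].  It vanishes at [k = 0], so that products of weights taken
    at truncated differences [n - i] are zero past [n].  The parameters form
    a sequence over an arbitrary field, because the weights are needed both
    over the scalars and over the rational functions. *)
Definition lowering (K : fieldType) (alpha : seq K) (rho : K) (k : nat) : K :=
  k%:R * (rho * \prod_(a <- alpha) (k%:R + a)).

Lemma rmorph_lowering (K L : fieldType) (f : {rmorphism K -> L}) alpha rho k :
  f (lowering alpha rho k) = lowering [seq f a | a <- alpha] (f rho) k.
Proof.
rewrite /lowering !rmorphM rmorph_nat rmorph_prod big_map; congr (_ * (_ * _)).
by apply: eq_bigr => a _; rewrite rmorphD rmorph_nat.
Qed.

(** * Action of the operators on the falling factorials *)

Section Operators.
Variable C : fieldType.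
Implicit Types (p f : {poly C}).

Lemma psiE n : psi C n = falling 'X n.
Proof. by rewrite /psi -signed_poch -mul_polyC rmorphXn /= polyCN. Qed.

Lemma horner_psi n x : (psi C n).[x] = falling x n.
Proof.
rewrite psiE /falling horner_prod; apply: eq_bigr => i _.
by rewrite -polyC_natr !hornerE.
Qed.

Lemma comp_falling n p : falling 'X n \Po p = falling p n.
Proof.
rewrite [LHS](rmorph_falling (comp_poly p)) /=; congr falling.
exact: comp_polyX.
Qed.

Lemma Delta_psi n : Delta (psi C n) = n%:R *: psi C n.-1.
Proof.
rewrite /Delta psiE comp_falling.
case: n => [|n]; first by rewrite /falling !big_ord0 subrr scale0r.
rewrite fallingSl addrK fallingSr psiE /= -mul_polyC polyC_natr -natr1; ring.
Qed.

Lemma Hop_psi n : Hop (psi C n) = n%:R *: psi C n.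
Proof.
rewrite /Hop /Nabla psiE comp_falling.
case: n => [|n]; first by rewrite /falling !big_ord0 subrr mulr0 oppr0 scale0r.
rewrite (fallingSr ('X - 1)) fallingSl -mul_polyC polyC_natr -natr1; ring.
Qed.

Lemma HopZ c f : Hop (c *: f) = c *: Hop f.
Proof.
by rewrite /Hop /Nabla linearZ -scalerBr -scalerAr scalerN.
Qed.

(** On an eigenvector of [T], evaluating a polynomial at [T] amounts to
    evaluating it at the eigenvalue.  The multiple [b] is built in because [T]
    is any map that respects scaling. *)
Lemma op_eval_eigen p (T : {poly C} -> {poly C}) (c b : C) f :
  (forall a g, T (a *: g) = a *: T g) -> T f = c *: f ->
  op_eval p T (b *: f) = (b * p.[c]) *: f.
Proof.
move=> TZ Tf.
have iterT i : iter i T (b *: f) = (b * c ^+ i) *: f.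
  elim: i => [|i IHi]; first by rewrite mulr1.
  by rewrite iterS IHi TZ Tf scalerA exprSr mulrA.
rewrite /op_eval horner_coef mulr_sumr scaler_suml; apply: eq_bigr => i _.
by rewrite iterT scalerA; congr (_ *: _); ring.
Qed.

Variables (d : nat) (alpha : d.-tuple C) (rho : C).

(** After [Delta], which contributes [n], the operator [R(H)] acts on
    [psi (n - 1)] and contributes [R(n - 1)]; the shift in
    [H + a + 1] turns [n - 1] into [n + a]. *)
Lemma Gop_psi c n :
  Gop alpha rho (c *: psi C n) =
  (c * lowering alpha rho n) *: psi C n.-1.
Proof.
rewrite /Gop /Delta linearZ -scalerBr -/(Delta _) Delta_psi scalerA.
rewrite (op_eval_eigen _ _ HopZ (Hop_psi _)).
case: n => [|n]; first by rewrite /lowering /= !(mulr0, mul0r).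
congr (_ *: _); rewrite /lowering -mulrA; congr (_ * (_ * _)).
rewrite hornerZ horner_prod; congr (_ * _); apply: eq_bigr => a _.
by rewrite !hornerE /= -natr1; ring.
Qed.

Lemma iter_Gop_psi n j :
  iter j (Gop alpha rho) (psi C n) =
  (\prod_(i < j) lowering alpha rho (n - i)) *: psi C (n - j).
Proof.
elim: j => [|j IHj]; first by rewrite big_ord0 subn0 scale1r.
by rewrite iterS IHj Gop_psi big_ord_recr subnS.
Qed.

(** The exponential series stops at [j = n]: a later product of weights
    contains the weight at zero. *)
Lemma PpolyE n :
  Ppoly alpha rho n =
  \sum_(j < n.+1)
     (j`!%:R^-1 * \prod_(i < j) lowering alpha rho (n - i)) *: psi C (n - j).
Proof.
rewrite /Ppoly /op_exp (@sum_nat_support _ _ n) => [|j nj].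
  by apply: eq_bigr => j _; rewrite iter_Gop_psi scalerA.
rewrite iter_Gop_psi (bigD1 (Ordinal nj)) //= subnn /lowering.
by rewrite !mul0r scale0r scaler0.
Qed.

End Operators.

(** * The two hypergeometric sums *)

Section Hypergeometric.
Variables (K : fieldType) (alpha : seq K) (rho : K) (n : nat) (x : K).

(** Each weight at [n - i] differs from the corresponding Pochhammer factors
    [- n + i] and [- n - a + i] by [size alpha + 1] changes of sign, which
    explains the sign in the argument of the first series. *)
Lemma prod_lowering_down j : (j <= n)%N ->
  \prod_(i < j) lowering alpha rho (n - i) =
  (\prod_(a <- - n%:R :: [seq - n%:R - a | a <- alpha]) poch a j) *
  ((-1) ^+ (size alpha).+1 * rho) ^+ j.
Proof.
move=> jn; rewrite big_cons big_map /poch exchange_big /=.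
rewrite -[j in _ ^+ j]card_ord -prodr_const -!big_split /=.
apply: eq_bigr => i _.
have -> : \prod_(a <- alpha) (- n%:R - a + i%:R) =
          (-1) ^+ size alpha * \prod_(a <- alpha) ((n - i)%:R + a).
  rewrite natrB; last by apply: leq_trans jn; apply: ltnW.
  elim: alpha => [|a s IHs]; first by rewrite !big_nil mulr1.
  by rewrite !big_cons IHs /= exprS; ring.
rewrite /lowering natrB; last by apply: leq_trans jn; apply: ltnW.
(* The signs from the parameters and from the argument cancel in pairs. *)
rewrite exprS; set P := \prod_(_ <- _) _; set s := (-1) ^+ _.
have ss : s * s = 1 by rewrite -expr2 sqrr_sign.
transitivity ((n%:R - i%:R) * (rho * P) * (s * s)); last by ring.
by rewrite ss mulr1.
Qed.

(** The condition on [x] says that [falling x n] is nonzero; the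
    denominators [(x - n + 1)_j] are tails of this product, hence nonzero. *)
Lemma first_representation : (forall k, (k < n)%N -> x != k%:R) ->
  \sum_(j < n.+1)
     (j`!%:R^-1 * \prod_(i < j) lowering alpha rho (n - i)) *
     falling x (n - j) =
  (-1) ^+ n * poch (- x) n *
  hyp (- n%:R :: [seq - n%:R - a | a <- alpha]) [:: x - n%:R + 1]
      ((-1) ^+ (size alpha).+1 * rho).
Proof.
move=> x_neq; rewrite hyp_terminating signed_poch mulr_sumr.
have fall_neq0 : falling x n != 0.
  by apply/prodf_neq0 => i _; rewrite subr_eq0 x_neq.
apply: eq_bigr => -[j /= jn] _; rewrite ltnS in jn.
rewrite prod_lowering_down // /hyp_term big_seq1.
move: fall_neq0; rewrite (falling_split x jn) mulf_eq0 negb_or.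
case/andP=> _ poch_neq0.
set N := \prod_(_ <- _) _; set p := poch (x - _ + _) _ in poch_neq0 *.
by rewrite -[falling x (n - j) in LHS](mulfK poch_neq0); ring.
Qed.

Lemma prod_lowering_up m :
  \prod_(i < m) lowering alpha rho i.+1 =
  m`!%:R * (rho ^+ m * \prod_(a <- alpha) poch (a + 1) m).
Proof.
elim: m => [|m IHm].
  rewrite big_ord0 big1 ?mulr1 // => a _; exact: big_ord0.
rewrite big_ord_recr /= IHm factS natrM exprS /lowering.
under [in RHS]eq_bigr do rewrite /poch big_ord_recr.
rewrite /= big_split /=.
have -> : \prod_(a <- alpha) (m.+1%:R + a) = \prod_(a <- alpha) (a + 1 + m%:R).
  by apply: eq_bigr => a _; rewrite -natr1; ring.
by rewrite /poch; ring.
Qed.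

Lemma prod_lowering_telescope k : (k <= n)%N ->
  (\prod_(i < k) lowering alpha rho i.+1) *
  \prod_(i < n - k) lowering alpha rho (n - i) =
  \prod_(i < n) lowering alpha rho i.+1.
Proof.
move=> kn; rewrite -[in RHS](subnKC kn) big_split_ord /=; congr (_ * _).
rewrite [RHS](reindex_inj rev_ord_inj) /=; apply: eq_bigr => i _.
have := ltn_ord i; move: (val i) => {i} i i_lt; congr lowering.
by rewrite -addnS subnSK // addnBA 1?ltnW // subnKC.
Qed.

End Hypergeometric.

(** With [k! rho ^ k \prod_a (a + 1)_k] invertible, the product of the upper
    [n - k] weights is a quotient of two full products, and
    [n! / (n - k)!] is [(- n)_k] up to a sign that [(- x)_k] compensates.
    Characteristic zero makes the factorials invertible. *)
Lemma second_representation (K : numFieldType) (alpha : seq K) (rho : K)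
    (n : nat) (x : K) :
  rho != 0 -> (forall a m, a \in alpha -> a != - m.+1%:R) ->
  \sum_(j < n.+1)
     (j`!%:R^-1 * \prod_(i < j) lowering alpha rho (n - i)) *
     falling x (n - j) =
  rho ^+ n * (\prod_(a <- alpha) poch (a + 1) n) *
  hyp [:: - n%:R; - x] [seq a + 1 | a <- alpha] rho^-1.
Proof.
move=> rho0 alphaN; rewrite hyp_terminating mulr_sumr.
(* Sum over the index [k = n - j] of the falling factorial. *)
rewrite (reindex_inj rev_ord_inj); apply: eq_bigr => -[k /= kn] _.
rewrite subSS; rewrite ltnS in kn.
rewrite (subKn kn) /hyp_term big_map big_cons big_seq1 !poch_opp falling_nat.
have fact0 m : (m`!%:R : K) != 0 by rewrite Num.Theory.pnatr_eq0 -lt0n fact_gt0.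
set Pk := \prod_(a <- alpha) poch (a + 1) k.
have Pk0 : Pk != 0.
  rewrite /Pk prodf_seq_neq0; apply/allP => a a_in /=.
  apply/prodf_neq0 => i _; rewrite -addrA nat1r addr_eq0; exact: alphaN.
have := prod_lowering_telescope alpha rho kn; rewrite !prod_lowering_up -/Pk.
set Pn := \prod_(a <- alpha) poch (a + 1) n; set Q := \prod_(_ < _) _ => eqQ.
(* [n! = F * (n - k)!], where [F] is, up to sign, [(- n)_k]. *)
rewrite -(ffact_fact kn) natrM in eqQ.
set F := (n ^_ k)%:R in eqQ *.
have rhok0 : rho ^+ k != 0 by rewrite expf_neq0.
have {eqQ} -> :
    Q = F * (n - k)`!%:R * (rho ^+ n * Pn) / (k`!%:R * (rho ^+ k * Pk)).
  by rewrite -eqQ; field; rewrite rhok0 Pk0 fact0.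
rewrite exprVn.
have ss : (-1) ^+ k * (-1) ^+ k = 1 :> K by rewrite -expr2 sqrr_sign.
rewrite [(-1) ^+ k * F * _]mulrACA ss mul1r.
by field; rewrite rhok0 Pk0 !fact0.
Qed.

(** * Values of [Ppoly] at a scalar and at the indeterminate *)

Section FractionField.
Variable C : fieldType.

(** The composite form carries the ring morphism structure of the embedding
    of the constants. *)
Let const : {rmorphism C -> {fraction {poly C}}} := @tofrac {poly C} \o polyC.

Lemma ratconstE : @ratconst C = const.
Proof. by []. Qed.

Lemma tofracZ (c : C) (p : {poly C}) : tofrac (c *: p) = ratconst c * tofrac p.
Proof. by rewrite -mul_polyC tofracM. Qed.

Lemma ratX_neq_nat (k : nat) : ratX C != k%:R.
Proof.
rewrite -(rmorph_nat (@tofrac {poly C})) tofrac_eq -subr_eq0.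
by rewrite -polyC_natr monic_neq0 // monicXsubC.
Qed.

(** A polynomial, seen as a rational function, is its own value at the
    indeterminate; this has the form to which [first_representation] applies
    over the field of rational functions. *)
Lemma tofrac_Ppoly d (alpha : d.-tuple C) (rho : C) n :
  tofrac (Ppoly alpha rho n) =
  \sum_(j < n.+1)
     (j`!%:R^-1 *
      \prod_(i < j)
        lowering [seq ratconst a | a <- alpha] (ratconst rho) (n - i)) *
     falling (ratX C) (n - j).
Proof.
rewrite PpolyE rmorph_sum; apply: eq_bigr => j _.
rewrite [LHS]tofracZ psiE (rmorph_falling (@tofrac {poly C})) ratconstE.
rewrite rmorphM fmorphV rmorph_nat rmorph_prod; congr (_ * _ * _).
by apply: eq_bigr => i _; rewrite rmorph_lowering.
Qed.

End FractionField.

Lemma horner_Ppoly (C : fieldType) d (alpha : d.-tuple C) (rho : C) n x :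
  (Ppoly alpha rho n).[x] =
  \sum_(j < n.+1)
     (j`!%:R^-1 * \prod_(i < j) lowering alpha rho (n - i)) *
     falling x (n - j).
Proof.
by rewrite PpolyE horner_sum; apply: eq_bigr => j _; rewrite hornerZ horner_psi.
Qed.

(* First formula: an identity in C(x), and its value at every x where the
   denominators (x - n + 1)_j, j <= n, do not vanish.
   Second formula: P_n is monic, hence the factor rho ^ n and the argument
   1 / rho. *)
Theorem theorem3p8 (R : realType) (d : nat) (alpha : d.-tuple (complex R))
    (rho : complex R) (rho_neq0 : rho != 0) (n : nat) :
  [/\ tofrac (Ppoly alpha rho n) =
        (-1) ^+ n * poch (- ratX (complex R)) n *
        hyp (- n%:R :: [seq - n%:R - ratconst a | a <- alpha])
            [:: ratX (complex R) - n%:R + 1]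
            (ratconst ((-1) ^+ d.+1 * rho)),
      forall x : complex R, (forall k : nat, (k < n)%N -> x != k%:R) ->
        (Ppoly alpha rho n).[x] =
        (-1) ^+ n * poch (- x) n *
        hyp (- n%:R :: [seq - n%:R - a | a <- alpha])
            [:: x - n%:R + 1]
            ((-1) ^+ d.+1 * rho)
    & (forall (a : complex R) (m : nat), a \in alpha -> a != - m.+1%:R) ->
      forall x : complex R,
        (Ppoly alpha rho n).[x] =
        rho ^+ n * (\prod_(a <- alpha) poch (a + 1) n) *
        hyp [:: - n%:R; - x] [seq a + 1 | a <- alpha] rho^-1].
Proof.
split=> [|x x_neq|alphaN x].
- rewrite tofrac_Ppoly first_representation => [|k _]; last exact: ratX_neq_nat.
  rewrite size_map size_tuple -map_comp.
  by rewrite ratconstE rmorphM rmorphXn rmorphN1.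
- by rewrite horner_Ppoly first_representation // size_tuple.
- by rewrite horner_Ppoly second_representation.
Qed.
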